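(* Let $\Omega=\Omega(A)$ be a differential graded algebra of classical type, $\delta$ a degree $-1$ linear map on it of classical type, and $\tau\in\Omega^1$ strongly $\delta$-conformal with $\alpha\in A$ and constant $\beta\in k$. Let $0\ne\lambda\in k$ and let $\tilde{\tilde\Omega}(A)$ be the extended differential graded algebra built from $(\Omega,\delta)$. Then $\tau$ defines a derivation on $\tilde{\tilde\Omega}(A)$ (degree preserving and commuting with its exterior derivative $\mathrm d_\cdot$) by $$\tau(\theta')=\alpha\theta',\qquad\tau(\mathrm d\theta')=(\mathrm d\alpha)\theta'+\alpha\,\mathrm d\theta',$$ $$\tau(\omega)=\mathcal L_\tau\omega+\tfrac\lambda2(-1)^{|\omega|}(|\omega|-\beta)(\mathfrak i_{\mathrm d\alpha}\omega)\theta',\qquad\forall\omega\in\Omega.$$ The resulting semidirect product differential graded algebra $\tilde{\tilde\Omega}(A)\rtimes\Omega(t,\mathrm dt)$, in the case of a Riemannian manifold, essentially recovers the calculus of Theorem 3.1 of the author's (S. Majid's) earlier work on the differential quantisation of $M\times\mathbb R$.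
   Context: $k$ is a field of characteristic $\neq 2$ and $A$ a unital $k$-algebra. A DGA on $A$ is an associative graded algebra $\Omega=\oplus_{n\ge0}\Omega^n$ with $\Omega^0=A$ and a graded derivation $\mathrm d$ of degree 1, $\mathrm d^2=0$. It is standard if $\Omega^1$ is spanned by elements $a\,\mathrm db$ and $\Omega$ is generated by degrees $0,1$; of classical type if it is standard, graded-commutative, and equal to the tensor algebra of $\Omega^1$ over $A$ modulo the relations of antisymmetry. A degree $-1$ linear map $\delta$ on $\Omega$ is of classical type if: there is an $A$-bilinear map $\mathfrak i:\Omega^1\otimes_A\Omega^n\to\Omega^{n-1}$ with $\delta(a\omega)=a\delta\omega+\mathfrak i_{\mathrm da}\omega$; $\delta^2$ is $A$-linear; each $\mathfrak i_{\mathrm da}$ is a graded derivation of degree $-1$; and $\mathfrak i_{\mathrm da}(\mathrm db)=\mathfrak i_{\mathrm db}(\mathrm da)$ for all $a,b\in A$. Write $(\omega,\eta)=\mathfrak i_\omega\eta$ for $\omega,\eta\in\Omega^1$; $\mathcal L_\omega=\mathrm d\mathfrak i_\omega+\mathfrak i_\omega\mathrm d$ for $\omega\in\Omega^1$; $L_\delta(\omega,\eta)=\delta(\omega\eta)-(\delta\omega)\eta-(-1)^{|\omega|}\omega\delta\eta$; $(\omega_1\cdots\omega_m)\perp(\eta_1\cdots\eta_n)=\sum_{i,j}(-1)^{i+j}(\omega_i,\eta_j)\omega_1\cdots\widehat{\omega_i}\cdots\omega_m\eta_1\cdots\widehat{\eta_j}\cdots\eta_n$ for $\omega_i,\eta_j\in\Omega^1$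 (zero if an argument has degree $0$). $\tau$ is strongly $\delta$-conformal (with $\alpha\in A$, $\beta\in k$) if $[\delta,\mathcal L_\tau]\omega=\alpha\delta\omega+(|\omega|-\beta)\mathfrak i_{\mathrm d\alpha}\omega$ for all $\omega\in\Omega$. $\tilde{\tilde\Omega}(A)=\Omega\oplus\Omega\theta'\oplus\Omega\,\mathrm d\theta'$ is the DGA with $\theta'$ of degree 1, $\mathrm d_\cdot\theta'=\mathrm d\theta'$, $\theta'^2=\theta'\mathrm d\theta'=(\mathrm d\theta')\theta'=(\mathrm d\theta')^2=0$, $\theta'$ and $\mathrm d\theta'$ graded-commuting with $\Omega$, and for $\omega,\eta\in\Omega$: $\omega\cdot\eta=\omega\eta+\frac\lambda2(-1)^{|\omega|+|\eta|}[\![\omega,\eta]\!]\theta'-\frac\lambda2(-1)^{|\omega|}(\omega\perp\eta)\mathrm d\theta'$, $\mathrm d_\cdot\omega=\mathrm d\omega-\frac\lambda2(-1)^{|\omega|}(\Delta\omega)\theta'+\frac\lambda2(\delta\omega)\mathrm d\theta'$, where $\Delta=\mathrm d\delta+\delta\mathrm d$ and $[\![\omega,\eta]\!]=L_\delta(\omega,\eta)+\omega\perp\mathrm d\eta-(-1)^{|\omega|}\mathrm d(\omega\perp\eta)-(-1)^{|\omega|}(\mathrm d\omega)\perp\eta$. For any DGA $\Omega'$ with a degree-preserving derivation $\tau$ commuting with its differential $\mathrm d$, the semidirect product $\Omega'\rtimes\Omega(t,\mathrm dt)$ is the DGA generated by $\Omega'$, $t$, $\mathrm dt$ with $[\mathrm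 dt,t]=\lambda\mathrm dt$, $(\mathrm dt)^2=0$, $[t,\omega]=\lambda(\tau-|\omega|)\omega$ and graded commutator $[\mathrm dt,\omega\}=\lambda\mathrm d\omega$ for $\omega\in\Omega'$. The case of a Riemannian manifold: $A$ is the smooth functions on a Riemannian manifold $M$ of dimension $n$, $\Omega$ its differential forms, $\delta$ the codifferential, $\beta=n/2$. The calculus of the earlier work (in the special case where two further parameters of that work vanish, and after a change of sign of $\lambda$) is the low-degree noncommutative differential calculus on the algebra generated by $A$ and $t$ having the relations of $\tilde{\tilde\Omega}(A)$ and, for $a\in A$, $\omega\in\Omega^1$, the cross relations $[t,\omega]=\lambda(\mathcal L_\tau\omega-\omega)+\lambda^2\frac{n-2}{4}(\mathrm d\alpha,\omega)\theta'$, $[t,\theta']=\lambda(\alpha-1)\theta'$, $[t,\mathrm d\theta']=\lambda((\mathrm d\alpha)\theta'+(\alpha-2)\mathrm d\theta')$, $[\mathrm dt,a]=\lambda\mathrm d_\cdot a$, $\{\mathrm dt,\omega\}=\lambda\mathrm d_\cdot\omega$, $\{\mathrm dt,\theta'\}=\lambda\mathrm d\theta'$. *)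

(* Defs.v *)
From HB Require Import structures.
From mathcomp Require Import all_boot all_order all_algebra.

Set Implicit Arguments.
Unset Strict Implicit.
Unset Printing Implicit Defensive.

Import GRing.Theory.
Local Open Scope ring_scope.

(* A differential graded algebra on A is a k-algebra, internally graded by
   subspaces [homog n], with A = [homog 0].  Total elements are finite sums
   of homogeneous ones, so that operations of degree m - n such as products
   need no transport between graded components. *)
Structure dga (k : fieldType) := Dga {
  dga_alg :> algType k;
  homog : nat -> dga_alg -> Prop;
  dif : {linear dga_alg -> dga_alg};
  homog0 : forall n, homog n 0;
  homogP : forall n (c : k) x y, homog n x -> homog n y -> homog n (c *: x + y);
  homog_span : forall x, exists (N : nat) (c : nat -> dga_alg),
    (forall n, homog n (c n)) /\ x = \sum_(n < N) c n;
  homog_direct : forall (N : nat) (c : nat -> dga_alg),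
    (forall n, homog n (c n)) -> \sum_(n < N) c n = 0 ->
    forall n, (n < N)%N -> c n = 0;
  homog1 : homog 0 1;
  homogM : forall m n x y, homog m x -> homog n y -> homog (m + n) (x * y);
  homog_dif : forall n x, homog n x -> homog n.+1 (dif x);
  difM : forall n x y, homog n x ->
    dif (x * y) = dif x * y + (-1) ^+ n *: (x * dif y);
  difK : forall x, dif (dif x) = 0
}.

Arguments homog {k d} n x : rename.
Arguments dif {k d} : rename.

Definition dga_morphism (k : fieldType) (W B : dga k)
    (f : {lrmorphism W -> B}) : Prop :=
  (forall n x, homog n x -> homog n (f x)) /\ (forall x, f (dif x) = dif (f x)).

Definition standard (k : fieldType) (W : dga k) : Prop :=
  (forall w : W, homog 1 w -> exists s : seq (W * W),
     (forall p, p \in s -> homog 0 p.1 /\ homog 0 p.2) /\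
     w = \sum_(p <- s) p.1 * dif p.2) /\
  (forall P : W -> Prop,
     (forall x, homog 0 x -> P x) -> (forall x, homog 1 x -> P x) ->
     (forall x y, P x -> P y -> P (x + y)) ->
     (forall x y, P x -> P y -> P (x * y)) ->
     forall x, P x).

Definition graded_commutative (k : fieldType) (W : dga k) : Prop :=
  forall m n (x y : W), homog m x -> homog n y ->
    x * y = (-1) ^+ (m * n) *: (y * x).

(* W is the quotient of the tensor algebra of the bimodule W^1 over A = W^0 by
   the relations w (x) w' + w' (x) w = 0, expressed by its universal property:
   an algebra map out of the quotient is an algebra map f0 on A together with
   an A-bimodule map f1 on W^1 whose values anticommute. *)
Definition antisymmetric_tensor_algebra (k : fieldType) (W : dga k) : Prop :=
  forall (B : algType k) (f0 f1 : W -> B),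
    f0 1 = 1 ->
    (forall (c : k) a b, homog 0 a -> homog 0 b ->
       f0 (c *: a + b) = c *: f0 a + f0 b) ->
    (forall a b, homog 0 a -> homog 0 b -> f0 (a * b) = f0 a * f0 b) ->
    (forall (c : k) v w, homog 1 v -> homog 1 w ->
       f1 (c *: v + w) = c *: f1 v + f1 w) ->
    (forall a w, homog 0 a -> homog 1 w -> f1 (a * w) = f0 a * f1 w) ->
    (forall a w, homog 0 a -> homog 1 w -> f1 (w * a) = f1 w * f0 a) ->
    (forall v w, homog 1 v -> homog 1 w -> f1 v * f1 w + f1 w * f1 v = 0) ->
    exists g : {lrmorphism W -> B},
      [/\ forall a, homog 0 a -> g a = f0 a,
          forall w, homog 1 w -> g w = f1 w
        & forall g' : {lrmorphism W -> B},
            (forall a, homog 0 a -> g' a = f0 a) ->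
            (forall w, homog 1 w -> g' w = f1 w) -> g' =1 g].

Definition classical_dga (k : fieldType) (W : dga k) : Prop :=
  [/\ standard W, graded_commutative W & antisymmetric_tensor_algebra W].

(* [int w] is the interior product by w, meaningful for w of degree 1 only.
   It is determined by delta since W^1 is spanned by the a db. *)
Record classical_codifferential (k : fieldType) (W : dga k)
    (delta : {linear W -> W}) (int : W -> W -> W) : Prop := {
  codif0 : forall x, homog 0 x -> delta x = 0;
  homog_codif : forall n x, homog n.+1 x -> homog n (delta x);
  int0 : forall w x, homog 1 w -> homog 0 x -> int w x = 0;
  homog_int : forall n w x, homog 1 w -> homog n.+1 x -> homog n (int w x);
  int_linearl : forall (c : k) v w x, homog 1 v -> homog 1 w ->
    int (c *: v + w) x = c *: int v x + int w x;
  int_linearr : forall (c : k) w x y, homog 1 w ->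
    int w (c *: x + y) = c *: int w x + int w y;
  int_left : forall a w x, homog 0 a -> homog 1 w ->
    int (a * w) x = a * int w x;
  int_middle : forall a w x, homog 0 a -> homog 1 w ->
    int (w * a) x = int w (a * x);
  int_right : forall a w x, homog 0 a -> homog 1 w ->
    int w (x * a) = int w x * a;
  codif_mul : forall a x, homog 0 a ->
    delta (a * x) = a * delta x + int (dif a) x;
  codif2_mul : forall a x, homog 0 a ->
    delta (delta (a * x)) = a * delta (delta x);
  int_derivation : forall n a x y, homog 0 a -> homog n x ->
    int (dif a) (x * y) = int (dif a) x * y + (-1) ^+ n *: (x * int (dif a) y);
  int_sym : forall a b, homog 0 a -> homog 0 b ->
    int (dif a) (dif b) = int (dif b) (dif a)
}.

(* The defining formula for the operation _|_; the parity of p + q does not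
   depend on whether the factors are numbered from 0 or from 1.  Since W is
   generated in degrees 0 and 1, these conditions determine [perp]. *)
Record is_perp (k : fieldType) (W : dga k) (int perp : W -> W -> W) : Prop := {
  perp_linearl : forall (c : k) x y z,
    perp (c *: x + y) z = c *: perp x z + perp y z;
  perp_linearr : forall (c : k) x y z,
    perp z (c *: x + y) = c *: perp z x + perp z y;
  perp0l : forall a x, homog 0 a -> perp a x = 0;
  perp0r : forall a x, homog 0 a -> perp x a = 0;
  perp_prod : forall (m n : nat) (v : 'I_m -> W) (w : 'I_n -> W),
    (forall p, homog 1 (v p)) -> (forall q, homog 1 (w q)) ->
    perp (\prod_(p < m) v p) (\prod_(q < n) w q) =
    \sum_(p < m) \sum_(q < n) (-1) ^+ (p + q) *:
      (int (v p) (w q) * \prod_(r < m | r != p) v r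
                       * \prod_(r < n | r != q) w r)
}.

Section Operations.
Variables (k : fieldType) (W : dga k).
Variables (delta : {linear W -> W}) (int perp : W -> W -> W).

Definition lie (w x : W) : W := dif (int w x) + int w (dif x).

Definition laplacian (x : W) : W := dif (delta x) + delta (dif x).

(* In the next two definitions m stands for the degree of x. *)
Definition codif_defect (m : nat) (x y : W) : W :=
  delta (x * y) - delta x * y - (-1) ^+ m *: (x * delta y).

Definition bracket (m : nat) (x y : W) : W :=
  codif_defect m x y + perp x (dif y)
  - (-1) ^+ m *: dif (perp x y) - (-1) ^+ m *: perp (dif x) y.

Definition strongly_conformal (tau alpha : W) (beta : k) : Prop :=
  forall n x, homog n x ->
    delta (lie tau x) - lie tau (delta x) =
    alpha * delta x + (n%:R - beta) *: int (dif alpha) x.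

End Operations.

(* E is the DGA  W (+) W theta (+) W d theta,  W being embedded as a graded
   vector space (but not as a subalgebra) by inc; products and differentials
   in E are those written with a dot.  All remaining products follow from the
   ones below by associativity. *)
Record is_extended (k : fieldType) (W : dga k) (delta : {linear W -> W})
    (perp : W -> W -> W) (lambda : k)
    (E : dga k) (inc : {linear W -> E}) (theta : E) : Prop := {
  ext_decomposition : forall x : E, exists! w : W * W * W,
    x = inc w.1.1 + inc w.1.2 * theta + inc w.2 * dif theta;
  homog_inc : forall n x, homog n x -> homog n (inc x);
  homog_theta : homog 1 theta;
  inc1 : inc 1 = 1;
  theta_theta : theta * theta = 0;
  theta_dtheta : theta * dif theta = 0;
  dtheta_theta : dif theta * theta = 0;
  dtheta_dtheta : dif theta * dif theta = 0;
  theta_inc : forall n x, homog n x ->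
    theta * inc x = (-1) ^+ n *: (inc x * theta);
  dtheta_inc : forall x, dif theta * inc x = inc x * dif theta;
  inc_mul : forall m n x y, homog m x -> homog n y ->
    inc x * inc y = inc (x * y)
      + (lambda / 2%:R * (-1) ^+ (m + n)) *:
          (inc (bracket delta perp m x y) * theta)
      - (lambda / 2%:R * (-1) ^+ m) *: (inc (perp x y) * dif theta);
  dif_inc : forall n x, homog n x ->
    dif (inc x) = inc (dif x)
      - (lambda / 2%:R * (-1) ^+ n) *: (inc (laplacian delta x) * theta)
      + (lambda / 2%:R) *: (inc (delta x) * dif theta)
}.

Record dga_derivation (k : fieldType) (E : dga k) (T : E -> E) : Prop := {
  der_linear : forall (c : k) x y, T (c *: x + y) = c *: T x + T y;
  der_homog : forall n x, homog n x -> homog n (T x);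
  der_mul : forall x y, T (x * y) = T x * y + x * T y;
  der_dif : forall x, T (dif x) = dif (T x)
}.

Definition dga_relations (k : fieldType) (E : dga k) : Type :=
  forall B : dga k, (E -> B) -> B -> Prop.

(* S is the DGA generated by E and an element t of degree 0 (hence, as an
   algebra, by E, t and dt) subject to the relations R. *)
Definition dga_presented (k : fieldType) (E : dga k) (R : dga_relations E)
    (S : dga k) (j : {lrmorphism E -> S}) (t : S) : Prop :=
  [/\ dga_morphism j, homog 0 t, R S j t
    & forall (B : dga k) (f : {lrmorphism E -> B}) (s : B),
        dga_morphism f -> homog 0 s -> R B f s ->
        exists g : {lrmorphism S -> B},
          [/\ dga_morphism g, forall x, g (j x) = f x, g t = s
            & forall g' : {lrmorphism S -> B}, dga_morphism g' ->
                (forall x, g' (j x) = f x) -> g' t = s -> g' =1 g]].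

Definition time_relations (k : fieldType) (B : dga k) (lambda : k) (t : B) :
    Prop :=
  dif t * t - t * dif t = lambda *: dif t /\ dif t * dif t = 0.

Definition semidirect_relations (k : fieldType) (E : dga k) (T : E -> E)
    (lambda : k) : dga_relations E :=
  fun B f t =>
  [/\ time_relations lambda t,
      forall n x, homog n x ->
        t * f x - f x * t = lambda *: (f (T x) - n%:R *: f x)
    & forall n x, homog n x ->
        dif t * f x - (-1) ^+ n *: (f x * dif t) = lambda *: f (dif x)].

Definition is_semidirect (k : fieldType) (E : dga k) (T : E -> E) (lambda : k)
    (S : dga k) (j : {lrmorphism E -> S}) (t : S) : Prop :=
  dga_presented (semidirect_relations T lambda) j t.

(* The quantised differential calculus of M x R, for M of dimension n: the
   algebra is generated by A and t with [t, a] = lambda tau(a), where tau(a)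
   is the Lie derivative of a along tau; relations among elements of E come
   with the map f. *)
Definition quantum_calculus_relations (k : fieldType) (W : dga k)
    (int : W -> W -> W) (tau alpha : W) (n : nat) (lambda : k)
    (E : dga k) (inc : W -> E) (theta : E) : dga_relations E :=
  fun B f t =>
  [/\ time_relations lambda t,
      forall a, homog 0 a ->
        t * f (inc a) - f (inc a) * t = lambda *: f (inc (lie int tau a))
    & [/\ forall w, homog 1 w ->
            t * f (inc w) - f (inc w) * t =
            lambda *: (f (inc (lie int tau w)) - f (inc w))
            + (lambda ^+ 2 * ((n%:R - 2%:R) / 4%:R)) *:
                f (inc (int (dif alpha) w) * theta),
          t * f theta - f theta * t = lambda *: f ((inc alpha - 1) * theta)
        & t * f (dif theta) - f (dif theta) * t =
            lambda *: f (inc (dif alpha) * theta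
                         + (inc alpha - 2%:R) * dif theta)]
    /\ [/\ forall a, homog 0 a ->
             dif t * f (inc a) - f (inc a) * dif t = lambda *: f (dif (inc a)),
           forall w, homog 1 w ->
             dif t * f (inc w) + f (inc w) * dif t = lambda *: f (dif (inc w))
         & dif t * f theta + f theta * dif t = lambda *: f (dif theta)]].

Definition is_quantum_calculus (k : fieldType) (W : dga k)
    (int : W -> W -> W) (tau alpha : W) (n : nat) (lambda : k)
    (E : dga k) (inc : W -> E) (theta : E)
    (S : dga k) (j : {lrmorphism E -> S}) (t : S) : Prop :=
  dga_presented
    (quantum_calculus_relations int tau alpha n lambda inc theta) j t.

(* Main.v *)
(** The Lie derivative [L] along [tau] is a derivation of [W] commuting with [d].
Comparing conformality on [a x] and on [x] shows [[i_w, L] + i_(L w) = alpha i_w]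
for every 1-form [w]; since [(w x) _|_ y = x (i_w y) - w (x _|_ y)], it follows by
induction that [L] scales [_|_] by [alpha].  Conformality then controls how [L]
acts on the bracket and on the Laplacian, the error terms being multiples of
[i_(d alpha)] and of [d alpha]; these are exactly cancelled by the correction
in [theta'] of [tau(omega)] and by [tau(d theta')].  For the last part, both
sets of relations involve only commutators of [t] and [dt] with elements of the
extended algebra, are compatible with products, and agree on the generators
[A], [Omega^1], [theta'] and [d theta'], the one missing relation, that of [dt]
with [d theta'], being the differential of the relation of [dt] with [theta']. *)

Require Import Defs.
From HB Require Import structures.
From mathcomp Require Import all_boot all_order all_algebra.
From mathcomp Require Import ring.

Set Implicit Arguments.
Unset Strict Implicit.
Unset Printing Implicit Defensive.

Import GRing.Theory.
Local Open Scope ring_scope.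

(** * Deciding identities between linear combinations *)

Section LinearExpressions.
Variables (k : comNzRingType) (V : lmodType k).

(** Syntax of linear combinations over a list of atoms. An equality in a module is thereby reduced
    to one scalar equation per atom, which [ring] can close. *)
Inductive linexp :=
  | LZero | LVar of nat | LOpp of linexp | LAdd of linexp & linexp
  | LScale of k & linexp.

Fixpoint leval (vs : seq V) (e : linexp) : V :=
  match e with
  | LZero => 0
  | LVar i => nth 0 vs i
  | LOpp e1 => - leval vs e1
  | LAdd e1 e2 => leval vs e1 + leval vs e2
  | LScale c e1 => c *: leval vs e1
  end.

Fixpoint lcoef (i : nat) (e : linexp) : k :=
  match e with
  | LZero => 0
  | LVar j => if Nat.eqb i j then 1 else 0
  | LOpp e1 => - lcoef i e1
  | LAdd e1 e2 => lcoef i e1 + lcoef i e2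
  | LScale c e1 => c * lcoef i e1
  end.

Fixpoint lcoef_eq (n : nat) (e1 e2 : linexp) : Prop :=
  match n with
  | 0 => True
  | n'.+1 => lcoef n' e1 = lcoef n' e2 /\ lcoef_eq n' e1 e2
  end.

Lemma leval_sum vs e :
  leval vs e = \sum_(i < size vs) lcoef i e *: nth 0 vs i.
Proof.
elim: e => [|j|e IH|e1 IH1 e2 IH2|c e IH] /=.
- by rewrite big1 // => i _; rewrite scale0r.
- have [ltj | lej] := ltnP j (size vs); last first.
    rewrite nth_default // big1 // => i _.
    have -> : Nat.eqb i j = (nat_of_ord i == j) by [].
    by rewrite ltn_eqF ?scale0r // (leq_trans (ltn_ord i)).
  rewrite (bigD1 (Ordinal ltj)) //= (eqxx j : Nat.eqb j j = true) scale1r big1 ?addr0 //.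
  move=> i; rewrite -val_eqE /= => /negbTE nij.
  have -> : Nat.eqb i j = (nat_of_ord i == j) by [].
  by rewrite nij scale0r.
- by rewrite IH -sumrN; apply: eq_bigr => i _; rewrite scaleNr.
- by rewrite IH1 IH2 -big_split; apply: eq_bigr => i _; rewrite scalerDl.
- by rewrite IH scaler_sumr; apply: eq_bigr => i _; rewrite scalerA.
Qed.

Lemma leval_eq vs e1 e2 :
  lcoef_eq (size vs) e1 e2 -> leval vs e1 = leval vs e2.
Proof.
move=> eqc; rewrite !leval_sum; apply: eq_bigr => i _; congr (_ *: _).
elim: (size vs) i eqc => [[//]|n IH] [i lti] /= [eqn eqc].
move: lti; rewrite ltnS leq_eqVlt => /orP[/eqP -> // | lti].
exact: (IH (Ordinal lti)).
Qed.

End LinearExpressions.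

(* Products are compared factor by factor, as the ring structure they mention
   may be reached along different inheritance paths. *)
Ltac same_atom x y :=
  tryif constr_eq x y then idtac else
  lazymatch x with
  | @GRing.mul _ ?a ?b =>
    lazymatch y with
    | @GRing.mul _ ?c ?d => same_atom a c; same_atom b d
    end
  | ?f ?a =>
    lazymatch y with
    | ?g ?b => same_atom a b; first [constr_eq f g | unify f g]
    end
  end.

Ltac lin_index x vs :=
  lazymatch vs with
  | ?y :: ?t =>
    let b := match constr:(Set) with
             | _ => let _ := match constr:(Set) with
                             | _ => same_atom x y end in constr:(true)
             | _ => constr:(false) end in
    lazymatch b with
    | true => constr:(0%N)
    | false => let i := lin_index x t in constr:(S i)
    end
  end.

Ltac lin_mem x vs :=
  match constr:(Set) with
  | _ => let i := lin_index x vs in constr:(true)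
  | _ => constr:(false)
  end.

Ltac lin_atoms e vs :=
  lazymatch e with
  | @GRing.add _ ?x ?y => let vs := lin_atoms x vs in lin_atoms y vs
  | @GRing.opp _ ?x => lin_atoms x vs
  | @GRing.scale _ _ _ ?x => lin_atoms x vs
  | @GRing.zero _ => vs
  | _ => let b := lin_mem e vs in
         lazymatch b with true => vs | false => constr:(e :: vs) end
  end.

Ltac lin_reify k e vs :=
  lazymatch e with
  | @GRing.add _ ?x ?y =>
    let x := lin_reify k x vs in let y := lin_reify k y vs in
    constr:(@LAdd k x y)
  | @GRing.opp _ ?x => let x := lin_reify k x vs in constr:(@LOpp k x)
  | @GRing.scale _ _ ?c ?x =>
    let x := lin_reify k x vs in constr:(@LScale k c x)
  | @GRing.zero _ => constr:(@LZero k)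
  | _ => let i := lin_index e vs in constr:(@LVar k i)
  end.

(* Reduces an equality between linear combinations over [k] to the equality
   of the coefficients of each atom. *)
Ltac lin_coefs k :=
  lazymatch goal with
  | |- @eq ?T ?l ?r =>
    let vs := lin_atoms l (@nil T) in
    let vs := lin_atoms r vs in
    let e1 := lin_reify k l vs in
    let e2 := lin_reify k r vs in
    refine (@leval_eq k _ vs e1 e2 _); cbv [lcoef_eq lcoef size Nat.eqb];
    repeat split
  end.

Lemma signr_cases (R : pzRingType) n : (-1) ^+ n = 1 :> R \/ (-1) ^+ n = -1 :> R.
Proof. by rewrite -signr_odd; case: (odd n); [right | left]. Qed.

(** Signs with a variable exponent lie beyond [ring]: exponents are first broken up, then each
    remaining power of -1 is replaced by 1 and by -1 in turn. *)
Ltac split_signs k :=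
  rewrite ?(exprD, exprS, expr0);
  repeat match goal with
  | |- context [@GRing.exp _ (-1) ?n] => case: (signr_cases k n) => ->
  end.

Ltac lin k := lin_coefs k; split_signs k; ring.

(** Subtracts a known equation from the goal. Chained uses, with suitable scalar multiples, exhibit
    the goal as a linear combination of hypotheses, checked at the end by [lin]. *)
Lemma lin_use (V : zmodType) (x y u v : V) : x = y -> u - v = x - y -> u = v.
Proof. by move=> ->; rewrite subrr => /subr0_eq. Qed.

(** * Graded and classical algebras *)

Section GradedAlgebra.
Variables (k : fieldType) (W : dga k).
Implicit Types x y z : W.

Lemma homogD n x y : homog n x -> homog n y -> homog n (x + y).
Proof. by move=> hx hy; rewrite -[x]scale1r; apply: homogP. Qed.

Lemma homogZ n c x : homog n x -> homog n (c *: x).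
Proof. by move=> hx; rewrite -[_ *: x]addr0; apply: homogP; last exact: homog0. Qed.

Lemma homogN n x : homog n x -> homog n (- x).
Proof. by rewrite -scaleN1r; apply: homogZ. Qed.

Lemma homogB n x y : homog n x -> homog n y -> homog n (x - y).
Proof. by move=> hx /homogN; apply: homogD. Qed.

Lemma homog_ind (P : W -> Prop) :
  P 0 -> (forall x y, P x -> P y -> P (x + y)) ->
  (forall n x, homog n x -> P x) -> forall x, P x.
Proof.
move=> P0 PD Ph x; have [N [c [hc ->]]] := homog_span x.
by elim/big_ind: _ => // i _; apply: Ph (hc i).
Qed.

(* Since the grading is direct, a graded family of subspaces that jointly span
   the whole algebra exhausts each degree. *)
Lemma homog_graded_ind (P : nat -> W -> Prop) :
  (forall n, P n 0) -> (forall n x y, P n x -> P n y -> P n (x + y)) ->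
  (forall n x, P n x -> homog n x) ->
  (forall Q : W -> Prop, Q 0 -> (forall x y, Q x -> Q y -> Q (x + y)) ->
     (forall n x, P n x -> Q x) -> forall x, Q x) ->
  forall n x, homog n x -> P n x.
Proof.
move=> P0 PD Ph Pspan n x hx.
have [N [c [hc defx]]] : exists (N : nat) (c : nat -> W),
    (forall n, P n (c n)) /\ x = \sum_(n < N) c n.
  move: x {hx}; apply: Pspan => [|x y [N [c [hc ->]]] [M [d [hd ->]]]|m x Px].
  - by exists 0, (fun=> 0); split=> //; rewrite big_ord0.
  (* The values of [c] from [N] on and of [d] from [M] on are arbitrary, so both families are cut
     off before being added. *)
  - exists (maxn N M),
      (fun i => (if (i < N)%N then c i else 0) + (if (i < M)%N then d i else 0)).
    split=> [i|]; first by apply: PD; case: ifP.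
    rewrite big_split /= -!big_mkcond /=.
    by rewrite -!big_ord_widen ?leq_maxl ?leq_maxr.
  - exists m.+1, (fun i => if i == m then x else 0); split=> [i|].
      by case: eqP => [->|].
    by rewrite -big_mkcond (big_pred1 ord_max) // => i; rewrite -val_eqE.
(* Subtracting [x] in degree [n] from its own decomposition leaves a vanishing sum of homogeneous
   terms. Its term of degree [n] is then 0, so [x] is [c n], or 0 if [N <= n]. *)
pose c' i := (if (i < N)%N then c i else 0) - (if i == n then x else 0).
have hc' i : homog i (c' i).
  apply: homogB; last by case: eqP => [->|_] //; apply: homog0.
  by case: ifP => _; [apply: Ph | apply: homog0].
have ltn : (n < maxn N n.+1)%N by rewrite leq_maxr.
have : c' n = 0.
  apply: (@homog_direct _ _ (maxn N n.+1) c' hc' _ n ltn).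
  rewrite sumrB -!big_mkcond /= -big_ord_widen ?leq_maxl // -defx.
  by rewrite (big_pred1 (Ordinal ltn)) ?subrr // => i; rewrite -val_eqE.
by rewrite /c' eqxx => /subr0_eq <-; case: ifP.
Qed.

End GradedAlgebra.

(** * Induction principles for forms in a standard algebra *)

Section ClassicalAlgebra.
Variables (k : fieldType) (W : dga k) (hstd : standard W).
Hypothesis hcomm : graded_commutative W.
Implicit Types x y z : W.

Lemma one_form_ind (P : W -> Prop) :
  P 0 ->
  (forall v w, homog 1 v -> homog 1 w -> P v -> P w -> P (v + w)) ->
  (forall a b, homog 0 a -> homog 0 b -> P (a * dif b)) ->
  forall w, homog 1 w -> P w.
Proof.
move=> P0 PD Pdif w /(proj1 hstd)[s [hs ->]].
(* Homogeneity is carried along because [PD] asks for it in both summands. *)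
suff [] : homog 1 (\sum_(p <- s) p.1 * dif p.2) /\
          P (\sum_(p <- s) p.1 * dif p.2) by [].
rewrite big_seq; elim/big_ind: _ => [|x y [hx Px] [hy Py]|p /hs[h1 h2]].
- by split=> //; apply: homog0.
- by split; [apply: homogD | apply: PD].
- by split; [exact: homogM h1 (homog_dif h2) | apply: Pdif].
Qed.

(** The smallest set [S] closed under the three rules is stable under left multiplication by
    functions, which need not hold for [P] itself. By standardness [S] is then stable under left
    multiplication by all of [W], and it contains 1. *)
Lemma form_ind (P : W -> Prop) :
  (forall a, homog 0 a -> P a) ->
  (forall x y, P x -> P y -> P (x + y)) ->
  (forall w x, homog 1 w -> P x -> P (w * x)) ->
  forall x, P x.
Proof.
pose closed (S : W -> Prop) :=
  [/\ forall a, homog 0 a -> S a, forall x y, S x -> S y -> S (x + y)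
    & forall w x, homog 1 w -> S x -> S (w * x)].
pose S x := forall S', closed S' -> S' x.
have S_closed : closed S.
  split=> [a ha|x y Sx Sy|w x hw Sx] S' clS'; have [S0 SD SM] := clS'.
  - exact: S0.
  - by apply: SD; [apply: Sx | apply: Sy].
  - by apply: SM => //; apply: Sx.
have [S0 SD SM] := S_closed.
have SM0 a : homog 0 a -> forall x, S x -> S (a * x).
  move=> ha x Sx; suff [] : S x /\ S (a * x) by [].
  apply: (Sx (fun x => S x /\ S (a * x))).
  split=> [b hb|y z [Sy Say] [Sz Saz]|w y hw [Sy Say]].
  - by split; apply: S0 => //; exact: homogM ha hb.
  - by rewrite mulrDr; split; apply: SD.
  - by rewrite mulrA; split; apply: SM => //; exact: homogM ha hw.
move=> P0 PD PM x; suff Sx : S x by apply: Sx; split.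
rewrite -[x]mulr1; have : S 1 by apply: S0; apply: homog1.
move: 1 => z; move: x z; apply: (proj2 hstd) => [||x y IHx IHy z Sz|x y IHx IHy z Sz].
- exact: SM0.
- by move=> w hw x; apply: SM.
- by rewrite mulrDl; apply: SD; [apply: IHx | apply: IHy].
- by rewrite -mulrA; apply: IHx; apply: IHy.
Qed.

Lemma prod_form_ind (P : W -> Prop) :
  (forall a, homog 0 a -> P a) ->
  (forall x y, P x -> P y -> P (x + y)) ->
  (forall m (v : 'I_m -> W), (forall p, homog 1 (v p)) -> P (\prod_(p < m) v p)) ->
  forall x, P x.
Proof.
(* [P] is generalised because the step for [w * x] uses the induction hypothesis at the predicate
   [P (w * _)]. *)
move=> P0 PD Pprod x; move: x P P0 PD Pprod.
elim/form_ind=> [a ha|x y IHx IHy|w x hw IHx] P P0 PD Pprod.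
- exact: P0.
- exact: PD (IHx P P0 PD Pprod) (IHy P P0 PD Pprod).
apply: (IHx (fun x => P (w * x))) => [a ha|y z|m v hv].
- have := Pprod 1%N (fun=> w * a); rewrite big_ord1; apply=> _.
  exact: homogM hw ha.
- by rewrite mulrDr; apply: PD.
- have := Pprod m.+1 (fun i => if unlift ord0 i is Some p then v p else w).
  rewrite big_ord_recl unlift_none; under eq_bigr => i _ do rewrite liftK.
  by apply=> p; case: unliftP.
Qed.

(** The homogeneous elements satisfying [P] form a graded family which spans [W] by [form_ind], so
    [homog_graded_ind] applies. *)
Lemma graded_form_ind (P : nat -> W -> Prop) :
  (forall n, P n 0) -> (forall n x y, P n x -> P n y -> P n (x + y)) ->
  (forall a, homog 0 a -> P 0 a) ->
  (forall n w x, homog 1 w -> homog n x -> P n x -> P n.+1 (w * x)) ->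
  forall n x, homog n x -> P n x.
Proof.
move=> P0 PD Pa PM n x hx; suff [] : homog n x /\ P n x by [].
move: n x hx; apply: homog_graded_ind.
- by move=> n; split; first exact: homog0.
- by move=> n x y [hx Px] [hy Py]; split; [apply: homogD | apply: PD].
- by move=> n x [].
move=> Q Q0 QD QP x; move: x Q Q0 QD QP.
elim/form_ind=> [a ha|x y IHx IHy|w x hw IHx] Q Q0 QD QP.
- by apply: (QP 0%N); split=> //; apply: Pa.
- exact: QD (IHx Q Q0 QD QP) (IHy Q Q0 QD QP).
apply: (IHx (fun x => Q (w * x))) => [|y z Qy Qz|n y [hy Py]].
- by rewrite mulr0.
- by rewrite mulrDr; apply: QD.
- by apply: (QP n.+1); split; [exact: homogM hw hy | apply: PM].
Qed.

Lemma deg0_comm a x : homog 0 a -> x * a = a * x.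
Proof.
move=> ha; elim/homog_ind: x => [|x y IHx IHy|n x hx].
- by rewrite mul0r mulr0.
- by rewrite mulrDl mulrDr IHx IHy.
- by rewrite (hcomm hx ha) muln0 expr0 scale1r.
Qed.

End ClassicalAlgebra.

(** * Interior products and conformal derivations *)

Section InteriorProduct.
Variables (k : fieldType) (W : dga k) (hW : classical_dga W).
Variables (delta : {linear W -> W}) (int : W -> W -> W).
Hypothesis hdelta : classical_codifferential delta int.
Implicit Types x y z : W.

Let hstd : standard W. Proof. by case: hW. Qed.
Let hcomm : graded_commutative W. Proof. by case: hW. Qed.

Lemma intDr w x y : homog 1 w -> int w (x + y) = int w x + int w y.
Proof. by move=> hw; have := int_linearr hdelta 1 x y hw; rewrite !scale1r. Qed.

Lemma int0r w : homog 1 w -> int w 0 = 0.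
Proof. by move=> hw; apply: (int0 hdelta) => //; apply: homog0. Qed.

Lemma intZr w c x : homog 1 w -> int w (c *: x) = c *: int w x.
Proof.
by move=> hw; rewrite -[c *: x]addr0 (int_linearr hdelta) // int0r // addr0.
Qed.

Lemma intDl v w x : homog 1 v -> homog 1 w -> int (v + w) x = int v x + int w x.
Proof. by move=> hv hw; have := int_linearl hdelta 1 x hv hw; rewrite !scale1r. Qed.

Lemma int0l x : int 0 x = 0.
Proof.
have h0 := homog0 W 1; have := intDl x h0 h0.
by rewrite addr0 -[X in X = _]addr0 => /addrI.
Qed.

Lemma int_deg0 w a x : homog 1 w -> homog 0 a -> int w (a * x) = a * int w x.
Proof.
move=> hw ha.
by rewrite -(int_middle hdelta) // (deg0_comm hcomm) // (int_left hdelta).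
Qed.

(** The derivation rule is given for exact 1-forms only. Since [int] is linear over functions in its
    first argument and functions are central, it extends to the span of the [a * dif b]. *)
Lemma int_mul n w x y : homog 1 w -> homog n x ->
  int w (x * y) = int w x * y + (-1) ^+ n *: (x * int w y).
Proof.
move=> hw hx; move: w hw; apply: (one_form_ind hstd) => [|v w hv hw IHv IHw|a b ha hb].
- by rewrite !int0l mul0r mulr0 scaler0 addr0.
- by rewrite !intDl // IHv IHw mulrDl mulrDr; lin k.
have hdb := homog_dif hb.
rewrite !(int_left hdelta) // (int_derivation hdelta _ hb hx) mulrDr -scalerAr.
by rewrite !mulrA (deg0_comm hcomm x ha).
Qed.

Lemma prod_neq_ord0 n (v : 'I_n.+1 -> W) :
  \prod_(r < n.+1 | r != ord0) v r = \prod_(r < n) v (lift ord0 r).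
Proof. by rewrite big_mkcond big_ord_recl /= mul1r. Qed.

Lemma prod_neq_lift0 n (v : 'I_n.+1 -> W) q :
  \prod_(r < n.+1 | r != lift ord0 q) v r =
  v ord0 * \prod_(r < n | r != q) v (lift ord0 r).
Proof. by rewrite big_mkcond big_ord_recl /= [in RHS]big_mkcond. Qed.

Lemma int_prod w n (v : 'I_n -> W) : homog 1 w -> (forall q, homog 1 (v q)) ->
  int w (\prod_(q < n) v q) =
  \sum_(q < n) (-1) ^+ q *: (int w (v q) * \prod_(r < n | r != q) v r).
Proof.
move=> hw; elim: n v => [|n IH] v hv.
  by rewrite !big_ord0 (int0 hdelta) //; apply: homog1.
rewrite big_ord_recl (int_mul _ hw (hv _)) IH // [in RHS]big_ord_recl.
rewrite prod_neq_ord0 expr0 scale1r expr1 mulr_sumr scaler_sumr.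
congr (_ + _); apply: eq_bigr => q _; rewrite prod_neq_lift0 -scalerAr scalerA.
by rewrite !mulrA (deg0_comm hcomm (v ord0)) -?exprS //; apply: (homog_int hdelta).
Qed.

(** * The operation [perp] *)

Variable perp : W -> W -> W.
Hypothesis hperp : is_perp int perp.

Lemma perpDl x y z : perp (x + y) z = perp x z + perp y z.
Proof. by have := perp_linearl hperp 1 x y z; rewrite !scale1r. Qed.

Lemma perpDr x y z : perp z (x + y) = perp z x + perp z y.
Proof. by have := perp_linearr hperp 1 x y z; rewrite !scale1r. Qed.

(** The row [p = 0] of the double sum defining [perp] gives [x * int w y]. In the other rows [w]
    stays in front and the index shift produces the minus sign. This recursion replaces the double
    sum from here on. *)
Lemma perp_form_mul w x y : homog 1 w ->
  perp (w * x) y = x * int w y - w * perp x y.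
Proof.
move=> hw.
elim/(prod_form_ind hstd): y => [b hb|y z IHy IHz|n u hu].
- by rewrite !(perp0r hperp) // (int0 hdelta) // !mulr0 subr0.
- by rewrite !perpDr intDr // IHy IHz !mulrDr; lin k.
elim/(prod_form_ind hstd): x => [a ha|x y IHx IHy|m v hv].
(* For [x] of degree 0, [w * a] is itself a 1-form, and the double sum has a single row. *)
- have hwa : homog 1 (w * a) by exact: homogM hw ha.
  rewrite [perp a _](perp0l hperp) // mulr0 subr0.
  have := @perp_prod _ _ _ _ hperp 1 n (fun=> w * a) u.
  rewrite big_ord1 => -> // {}.
  rewrite big_ord1 int_prod // mulr_sumr; apply: eq_bigr => q _.
  rewrite big_pred0 ?mulr1 => [|r]; last by rewrite ord1.
  by rewrite (deg0_comm hcomm w ha) (int_left hdelta) // -scalerAr mulrA.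
- by rewrite mulrDr !perpDl IHx IHy mulrDl mulrDr; lin k.
pose v' i := if unlift ord0 i is Some p then v p else w.
have v'0 : v' ord0 = w by rewrite /v' unlift_none.
have v'S p : v' (lift ord0 p) = v p by rewrite /v' liftK.
have hv' p : homog 1 (v' p) by rewrite /v'; case: unliftP.
have -> : w * \prod_(p < m) v p = \prod_(p < m.+1) v' p.
  by rewrite big_ord_recl v'0; under [in RHS]eq_bigr => i _ do rewrite v'S.
rewrite !(perp_prod hperp) // big_ord_recl int_prod // !mulr_sumr -sumrN.
have prod_v' : \prod_(r < m) v' (lift ord0 r) = \prod_(p < m) v p.
  by apply: eq_bigr => i _; rewrite v'S.
congr (_ + _).
  apply: eq_bigr => q _; rewrite prod_neq_ord0 prod_v' v'0 add0n -scalerAr mulrA.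
  by rewrite (deg0_comm hcomm (\prod_(p < m) v p)) //; apply: (homog_int hdelta).
apply: eq_bigr => p _; rewrite mulr_sumr -sumrN; apply: eq_bigr => q _.
rewrite prod_neq_lift0 v'0 v'S -scalerAr !mulrA (deg0_comm hcomm w).
  rewrite lift0 addSn exprS mulN1r scaleNr.
  by under eq_bigr => i _ do rewrite v'S.
exact: (homog_int hdelta).
Qed.

(** The double predecessor truncates only if one argument has degree 0, and then [perp] vanishes. *)
Lemma homog_perp m n x y : homog m x -> homog n y ->
  homog (m + n).-2 (perp x y).
Proof.
move=> hx; move: m x hx n y; apply: (graded_form_ind hstd).
- by move=> m n y _; rewrite (perp0l hperp); apply: homog0.
- by move=> m x y IHx IHy n z hz; rewrite perpDl; apply: homogD;
    [apply: IHx | apply: IHy].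
- by move=> a ha n y _; rewrite (perp0l hperp) //; apply: homog0.
move=> m w x hw hx IHx [|n] y hy; first by rewrite (perp0r hperp) //; apply: homog0.
rewrite perp_form_mul // addSnnS !addnS /=; apply: homogB.
  exact: homogM hx (homog_int hdelta hw hy).
case: m hx IHx => [|m] hx IHx; first by rewrite (perp0l hperp) // mulr0; apply: homog0.
by have := homogM hw (IHx _ _ hy); rewrite addSn addnS.
Qed.

Lemma perp_form_comm m n v x y : homog m x -> homog n y -> homog 1 v ->
  perp x y * v = (-1) ^+ (m + n) *: (v * perp x y).
Proof.
case: m => [|m] hx; first by rewrite (perp0l hperp) // mul0r mulr0 scaler0.
case: n => [|n] hy hv; first by rewrite (perp0r hperp) // mul0r mulr0 scaler0.
rewrite (hcomm (homog_perp hx hy) hv) addSnnS !addnS /= muln1.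
by rewrite !exprS mulrA mulrNN mulr1 mul1r.
Qed.

(** * The Lie derivative along a 1-form *)

Lemma lie_linear tau : homog 1 tau -> linear (lie int tau).
Proof.
move=> htau c x y; rewrite /lie (int_linearr hdelta) // !linearP /=.
by rewrite (int_linearr hdelta) // scalerDr; lin k.
Qed.

Lemma lie_dif tau x : homog 1 tau -> lie int tau (dif x) = dif (lie int tau x).
Proof. by move=> htau; rewrite /lie linearD /= !difK int0r // addr0 add0r. Qed.

Lemma homog_lie tau n x : homog 1 tau -> homog n x -> homog n (lie int tau x).
Proof.
move=> htau hx.
apply: homogD; last exact: (homog_int hdelta htau (homog_dif hx)).
case: n hx => [|n] hx; last exact: homog_dif (homog_int hdelta htau hx).
by rewrite (int0 hdelta) // linear0; apply: homog0.
Qed.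

(** [int w x] has degree [n - 1]; writing its sign as minus that of [n] covers [n = 0] too, where
    [int w x] is 0. *)
Lemma dif_int_mul n w x y : homog 1 w -> homog n x ->
  dif (int w x * y) = dif (int w x) * y - (-1) ^+ n *: (int w x * dif y).
Proof.
case: n => [|n] hw hx.
  by rewrite (int0 hdelta) // !(mul0r, linear0) ?oppr0 ?addr0.
rewrite (difM _ (homog_int hdelta hw hx)); lin k.
Qed.

(** The anticommutator of two odd derivations is an even derivation: the mixed terms cancel by their
    signs. *)
Lemma lieM tau x y : homog 1 tau ->
  lie int tau (x * y) = lie int tau x * y + x * lie int tau y.
Proof.
move=> htau; elim/homog_ind: x => [|x z IHx IHz|n x hx].
- by rewrite /lie !(mul0r, linear0, int0r, addr0).
- move: IHx IHz; rewrite /lie !(mulrDl, linearD, intDr) //= => IHx IHz.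
  by apply: (lin_use IHx); apply: (lin_use IHz); lin k.
rewrite /lie (difM _ hx) (int_mul _ htau hx) intDr // intZr //.
rewrite (int_mul _ htau (homog_dif hx)) (int_mul _ htau hx).
rewrite linearD linearZ /= (dif_int_mul _ htau hx) (difM _ hx).
by rewrite !(mulrDl, mulrDr); lin k.
Qed.

(** Isolates the properties of the Lie derivative along [tau] used below; [conf_codif] is strong
    conformality solved for [delta (L x)]. *)
Record conformal_derivation (L : W -> W) (alpha : W) (beta : k) : Prop := {
  confM : forall x y, L (x * y) = L x * y + x * L y;
  conf_dif : forall x, L (dif x) = dif (L x);
  homog_conf : forall n x, homog n x -> homog n (L x);
  conf_codif : forall n x, homog n x ->
    delta (L x) = L (delta x) + alpha * delta x + (n%:R - beta) *: int (dif alpha) x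
}.

(** * Behaviour of [int], [perp], the bracket and the Laplacian under a conformal derivation *)

Variables (L : {linear W -> W}) (alpha : W) (beta : k).
Hypotheses (halpha : homog 0 alpha) (hL : conformal_derivation L alpha beta).

Let hdalpha : homog 1 (dif alpha). Proof. exact: homog_dif. Qed.

(* Conformality on [a * x] minus [a] times conformality on [x]. *)
Lemma int_dif_conf a x : homog 0 a ->
  int (L (dif a)) x + int (dif a) (L x) - L (int (dif a) x) =
  alpha * int (dif a) x.
Proof.
move=> ha; have hda := homog_dif ha.
elim/homog_ind: x => [|x y IHx IHy|n x hx].
- by rewrite linear0 !int0r ?mulr0 ?linear0 ?subr0 ?addr0 //; apply: (homog_conf hL).
- rewrite linearD !intDr ?mulrDr ?linearD -?IHx -?IHy //; last exact: (homog_conf hL).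
  by rewrite /=; lin k.
have := conf_codif hL (homogM ha hx).
have := congr1 (fun z => a * z) (conf_codif hL hx).
rewrite (confM hL) !(codif_mul hdelta) // !linearD /= !(codif_mul hdelta) //.
  rewrite !(confM hL) int_deg0 // add0n (conf_dif hL).
  rewrite !(mulrDr, mulrA) -!scalerAr (deg0_comm hcomm alpha ha).
  move=> E1 E2; apply: (lin_use E2); apply: (lin_use (esym E1)). lin k.
exact: (homog_conf hL).
Qed.

(** The left side is linear over functions in [w]: on [a * dif b] the two terms containing [L a]
    cancel. The case of exact 1-forms therefore suffices. *)
Lemma int_conf w x : homog 1 w ->
  int (L w) x + int w (L x) - L (int w x) = alpha * int w x.
Proof.
move: w; apply: (one_form_ind hstd) => [|v w hv hw IHv IHw|a b ha hb].
- by rewrite linear0 !int0l linear0 mulr0 !addr0 subr0.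
- have [hLv hLw] := (homog_conf hL hv, homog_conf hL hw).
  by rewrite linearD !intDl // mulrDr linearD -IHv -IHw /=; lin k.
have hdb := homog_dif hb.
have [hLa hLdb] := (homog_conf hL ha, homog_conf hL hdb).
have [h1 h2] := (homogM hLa hdb, homogM ha hLdb).
rewrite (confM hL) intDl // !(int_left hdelta) // (confM hL).
have := congr1 (fun z => a * z) (int_dif_conf x hb).
rewrite !(mulrDr, mulrN, mulrA) (deg0_comm hcomm alpha ha) => E.
by apply: (lin_use E); lin k.
Qed.

Lemma perp_conf x y :
  L (perp x y) + alpha * perp x y = perp (L x) y + perp x (L y).
Proof.
elim/(form_ind hstd): x => [a ha|x z IHx IHz|w x hw IHx].
- rewrite !(perp0l hperp) ?linear0 ?mulr0 ?addr0 //; exact: (homog_conf hL).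
- rewrite linearD !perpDl linearD mulrDr /=.
  by apply: (lin_use IHx); apply: (lin_use IHz); lin k.
have hLw := homog_conf hL hw.
rewrite (confM hL) perpDl !perp_form_mul // linearB /= !(confM hL).
have := congr1 (fun z => x * z) (int_conf y hw).
have := congr1 (fun z => w * z) IHx.
rewrite !(mulrDr, mulrN, mulrA) !(deg0_comm hcomm _ halpha) => E1 E2.
by apply: (lin_use (esym E1)); apply: (lin_use (esym E2)); lin k.
Qed.

(** Conformality on [x * y], [x] and [y] has the weights [m + n - beta], [m - beta] and [n - beta],
    which combine so that [beta] drops out. The term in [dif alpha] comes from differentiating
    [alpha * perp x y]. *)
Lemma bracket_conf m n x y : homog m x -> homog n y ->
  bracket delta perp m (L x) y + bracket delta perp m x (L y) =
  L (bracket delta perp m x y) + alpha * bracket delta perp m x y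
  + n%:R *: (int (dif alpha) x * y) + ((-1) ^+ m * m%:R) *: (x * int (dif alpha) y)
  - (-1) ^+ n *: (perp x y * dif alpha).
Proof.
move=> hx hy; rewrite /bracket /codif_defect.
have Exy := conf_codif hL (homogM hx hy).
rewrite (confM hL) linearD (int_mul _ hdalpha hx) /= in Exy.
have Ex := congr1 (fun z => z * y) (conf_codif hL hx).
have Ey := congr1 (fun z => x * z) (conf_codif hL hy).
have P0 := congr1 (fun z => dif z) (perp_conf x y).
have P1 := perp_conf x (dif y).
have P2 := perp_conf (dif x) y.
rewrite !linearD (difM _ halpha) /= in P0.
rewrite (perp_form_comm hx hy hdalpha).
rewrite -!(conf_dif hL) in P0 *; rewrite !linearD !linearN !linearZ /= !(confM hL).
rewrite !mulrDl -!scalerAl /= in Ex.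
rewrite !mulrDr -!scalerAr /= mulrA (deg0_comm hcomm _ halpha) in Ey.
rewrite !(mulrDr, mulrN) -!scalerAr !mulrA.
apply: (lin_use Exy); apply: (lin_use (esym Ex)).
apply: (lin_use (congr1 (fun z => (-1) ^+ m *: z) (esym Ey))).
apply: (lin_use (congr1 (fun z => (-1) ^+ m *: z) P0)).
apply: (lin_use (esym P1)).
apply: (lin_use (congr1 (fun z => (-1) ^+ m *: z) P2)).
by rewrite !(mulrN, mulrA); lin k.
Qed.

(** The weight [n.+1 - beta] is that of conformality on [dif x]; [dif alpha * delta x] comes from
    differentiating [alpha * delta x]. *)
Lemma laplacian_conf n x : homog n x ->
  laplacian delta (L x) =
  L (laplacian delta x) + alpha * laplacian delta x + dif alpha * delta x
  + (n%:R - beta) *: dif (int (dif alpha) x)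
  + (n.+1%:R - beta) *: int (dif alpha) (dif x).
Proof.
move=> hx; rewrite /laplacian (conf_codif hL hx) -(conf_dif hL).
rewrite (conf_codif hL (homog_dif hx)) !linearD linearZ /= (conf_dif hL).
by rewrite (difM _ halpha) mulrDr; lin k.
Qed.

Lemma codif_form_comm n x v : homog n x -> homog 1 v ->
  delta x * v = - (-1) ^+ n *: (v * delta x).
Proof.
case: n => [|n] hx hv; first by rewrite (codif0 hdelta) // mul0r mulr0 scaler0.
by rewrite (hcomm (homog_codif hdelta hx) hv) muln1 exprS mulN1r opprK.
Qed.

End InteriorProduct.

(** * The derivation of the extended algebra *)

Section ExtendedAlgebra.
Variables (k : fieldType) (W : dga k) (delta : {linear W -> W}).
Variables (perp : W -> W -> W) (lambda : k).
Variables (E : dga k) (inc : {linear W -> E}) (theta : E).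
Hypothesis hE : is_extended delta perp lambda inc theta.

(** The corrections in [inc x * inc y] are multiples of [theta] and [dif theta], both killed by a
    further [theta]. *)
Lemma inc_mul_theta x y : inc x * inc y * theta = inc (x * y) * theta.
Proof.
elim/homog_ind: x => [|x z IHx IHz|m x hx]; first by rewrite !(mul0r, linear0).
  by rewrite linearD !mulrDl linearD mulrDl IHx IHz.
elim/homog_ind: y => [|y z IHy IHz|n y hy]; first by rewrite !(mul0r, mulr0, linear0).
  by rewrite linearD !mulrDr linearD !mulrDl IHy IHz.
rewrite (inc_mul hE hx hy) !(mulrDl, mulNr) -!scalerAl -!mulrA.
by rewrite (theta_theta hE) (dtheta_theta hE) !mulr0 !scaler0 subr0 addr0.
Qed.

Lemma inc_mul_dtheta x y : inc x * inc y * dif theta = inc (x * y) * dif theta.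
Proof.
elim/homog_ind: x => [|x z IHx IHz|m x hx]; first by rewrite !(mul0r, linear0).
  by rewrite linearD !mulrDl linearD mulrDl IHx IHz.
elim/homog_ind: y => [|y z IHy IHz|n y hy]; first by rewrite !(mul0r, mulr0, linear0).
  by rewrite linearD !mulrDr linearD !mulrDl IHy IHz.
rewrite (inc_mul hE hx hy) !(mulrDl, mulNr) -!scalerAl -!mulrA.
by rewrite (theta_dtheta hE) (dtheta_dtheta hE) !mulr0 !scaler0 subr0 addr0.
Qed.

Lemma theta_inc_theta x : theta * inc x * theta = 0.
Proof.
elim/homog_ind: x => [|x z IHx IHz|m x hx]; first by rewrite linear0 mulr0 mul0r.
  by rewrite linearD mulrDr mulrDl IHx IHz addr0.
by rewrite (theta_inc hE hx) -scalerAl -mulrA (theta_theta hE) mulr0 scaler0.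
Qed.

Lemma theta_inc_dtheta x : theta * inc x * dif theta = 0.
Proof.
elim/homog_ind: x => [|x z IHx IHz|m x hx]; first by rewrite linear0 mulr0 mul0r.
  by rewrite linearD mulrDr mulrDl IHx IHz addr0.
by rewrite (theta_inc hE hx) -scalerAl -mulrA (theta_dtheta hE) mulr0 scaler0.
Qed.

Lemma dtheta_inc_theta x : dif theta * inc x * theta = 0.
Proof. by rewrite (dtheta_inc hE) -mulrA (dtheta_theta hE) mulr0. Qed.

Lemma dtheta_inc_dtheta x : dif theta * inc x * dif theta = 0.
Proof. by rewrite (dtheta_inc hE) -mulrA (dtheta_dtheta hE) mulr0. Qed.

Lemma ext_ind (P : E -> Prop) :
  P 0 -> (forall x y, P x -> P y -> P (x + y)) ->
  (forall n w, homog n w -> P (inc w)) ->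
  (forall n w, homog n w -> P (inc w * theta)) ->
  (forall n w, homog n w -> P (inc w * dif theta)) ->
  forall x, P x.
Proof.
move=> P0 PD Pinc Pth Pdth x.
have [[[a b] c] [-> _]] := ext_decomposition hE x.
apply: (PD); [apply: (PD)|] => /=.
- elim/homog_ind: a => [|y z IHy IHz|n y hy]; first by rewrite linear0.
    by rewrite linearD; apply: PD.
  exact: Pinc hy.
- elim/homog_ind: b => [|y z IHy IHz|n y hy]; first by rewrite linear0 mul0r.
    by rewrite linearD mulrDl; apply: PD.
  exact: Pth hy.
- elim/homog_ind: c => [|y z IHy IHz|n y hy]; first by rewrite linear0 mul0r.
    by rewrite linearD mulrDl; apply: PD.
  exact: Pdth hy.
Qed.

Lemma ext_homog_ind (P : nat -> E -> Prop) :
  (forall n, P n 0) -> (forall n x y, P n x -> P n y -> P n (x + y)) ->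
  (forall n w, homog n w -> P n (inc w)) ->
  (forall n w, homog n w -> P n.+1 (inc w * theta)) ->
  (forall n w, homog n w -> P n.+2 (inc w * dif theta)) ->
  forall n x, homog n x -> P n x.
Proof.
move=> P0 PD Pinc Pth Pdth n x hx; suff [] : homog n x /\ P n x by [].
move: n x hx; apply: homog_graded_ind.
- by move=> n; split; first exact: homog0.
- by move=> n x y [hx Px] [hy Py]; split; [apply: homogD | apply: PD].
- by move=> n x [].
have [hth hdth] := (homog_theta hE, homog_dif (homog_theta hE)).
move=> Q Q0 QD QP; apply: ext_ind => // n w hw; have hiw := homog_inc hE hw.
- by apply: (QP n); split=> //; apply: Pinc.
- by apply: (QP n.+1); split; [rewrite -addn1; apply: homogM | apply: Pth].
- by apply: (QP n.+2); split; [rewrite -addn2; apply: homogM | apply: Pdth].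
Qed.

(** Stated with the boolean equality so that [xchoose] can select coordinates. *)
Lemma ext_coordE (x : E) : exists w : W * W * W,
  x == inc w.1.1 + inc w.1.2 * theta + inc w.2 * dif theta.
Proof. by have [w [-> _]] := ext_decomposition hE x; exists w. Qed.

Definition ext_coord (x : E) : W * W * W := xchoose (ext_coordE x).

Lemma ext_coordK x : let w := ext_coord x in
  x = inc w.1.1 + inc w.1.2 * theta + inc w.2 * dif theta.
Proof. exact/eqP/(xchooseP (ext_coordE x)). Qed.

Lemma ext_coord_uniq a b c :
  ext_coord (inc a + inc b * theta + inc c * dif theta) = (a, b, c).
Proof.
set x := (_ + _); have [w [_ w_uniq]] := ext_decomposition hE x.
by rewrite -(w_uniq _ (ext_coordK x)); apply: w_uniq.
Qed.

Definition ext_map (T0 T1 T2 : W -> E) (x : E) : E :=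
  let w := ext_coord x in T0 w.1.1 + T1 w.1.2 + T2 w.2.

Section ExtMap.
Variables T0 T1 T2 : {linear W -> E}.
Local Notation T := (ext_map T0 T1 T2).

Lemma ext_map_linear : linear T.
Proof.
move=> c x y; rewrite {1}(ext_coordK x) {1}(ext_coordK y) /ext_map.
case: (ext_coord x) => [[a b] d]; case: (ext_coord y) => [[a' b'] d'] /=.
have -> : c *: (inc a + inc b * theta + inc d * dif theta)
    + (inc a' + inc b' * theta + inc d' * dif theta) =
  inc (c *: a + a') + inc (c *: b + b') * theta + inc (c *: d + d') * dif theta.
  by rewrite !linearP /= !mulrDl -!scalerAl; lin k.
by rewrite ext_coord_uniq /= !linearP /=; lin k.
Qed.

Lemma ext_map_inc a : T (inc a) = T0 a.
Proof.
have -> : inc a = inc a + inc 0 * theta + inc 0 * dif theta.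
  by rewrite linear0 !mul0r !addr0.
by rewrite /ext_map ext_coord_uniq /= !linear0 !addr0.
Qed.

Lemma ext_map_theta a : T (inc a * theta) = T1 a.
Proof.
have -> : inc a * theta = inc 0 + inc a * theta + inc 0 * dif theta.
  by rewrite linear0 !mul0r addr0 add0r.
by rewrite /ext_map ext_coord_uniq /= !linear0 addr0 add0r.
Qed.

Lemma ext_map_dtheta a : T (inc a * dif theta) = T2 a.
Proof.
have -> : inc a * dif theta = inc 0 + inc 0 * theta + inc a * dif theta.
  by rewrite linear0 !mul0r !add0r.
by rewrite /ext_map ext_coord_uniq /= !linear0 !add0r.
Qed.

End ExtMap.

(** * The derivation on each of the three summands *)

Variable int : W -> W -> W.
Hypotheses (hW : classical_dga W) (hdelta : classical_codifferential delta int).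
Hypothesis hperp : is_perp int perp.
Variables (L : {linear W -> W}) (alpha : W) (beta : k).
Hypotheses (halpha : homog 0 alpha) (hL : conformal_derivation delta int L alpha beta).

Let hdalpha : homog 1 (dif alpha). Proof. exact: homog_dif. Qed.
Let hcomm : graded_commutative W. Proof. by case: hW. Qed.

Let L1 : L 1 = 0.
Proof.
by have := confM hL 1 1; rewrite !mulr1 mul1r -[X in X = _]addr0 => /addrI.
Qed.

(* Conformality rewrites [(m - beta) int (dif alpha) w] as an expression
   linear in [w], and the sign [(-1) ^+ m] is produced by moving [theta] to
   the left. *)
Definition tau0 (w : W) : E :=
  inc (L w) - (lambda / 2%:R) *:
    (theta * inc (delta (L w) - L (delta w) - alpha * delta w)).

Lemma tau0_linear : linear tau0.
Proof.
move=> c x y; rewrite /tau0 !linearP /= [alpha * _]mulrDr -[alpha * _]scalerAr.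
by rewrite !(linearD, linearN, linearZ) /= !(mulrDr, mulrN) -!scalerAr !mulrN; lin k.
Qed.

HB.instance Definition _ := GRing.isLinear.Build k W E _ tau0 tau0_linear.

Lemma tau0E m w : homog m w ->
  tau0 w = inc (L w) + (lambda / 2%:R * (-1) ^+ m * (m%:R - beta)) *:
    (inc (int (dif alpha) w) * theta).
Proof.
move=> hw; rewrite /tau0 (conf_codif hL hw).
have -> : L (delta w) + alpha * delta w + (m%:R - beta) *: int (dif alpha) w
    - L (delta w) - alpha * delta w = (m%:R - beta) *: int (dif alpha) w.
  by lin k.
(* In degree 0 the interior product vanishes; otherwise [theta] passes a form of degree one less
   than that of [w], which absorbs the minus sign. *)
rewrite [inc (_ *: int _ _)]linearZ /= -scalerAr; case: m hw => [|m] hw.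
  by rewrite (int0 hdelta) // linear0 mulr0 mul0r !scaler0 subr0 addr0.
by rewrite (theta_inc hE (homog_int hdelta hdalpha hw)); lin k.
Qed.

(** This value and [tau2] are forced by the product rule from [tau0] and the prescribed values on
    [theta] and [dif theta], the correction in [tau0] being killed. *)
Definition tau1 (w : W) : E := inc (L w + w * alpha) * theta.

Definition tau2 (w : W) : E :=
  inc (L w + w * alpha) * dif theta + inc (w * dif alpha) * theta.

Lemma tau1_linear : linear tau1.
Proof.
move=> c x y; rewrite /tau1 linearP mulrDl -scalerAl addrACA -scalerDr.
by rewrite linearP /= mulrDl -scalerAl.
Qed.

Lemma tau2_linear : linear tau2.
Proof.
move=> c x y; rewrite /tau2 linearP mulrDl -scalerAl addrACA -scalerDr mulrDl.
by rewrite -scalerAl !linearP /= !mulrDl -!scalerAl; lin k.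
Qed.

HB.instance Definition _ := GRing.isLinear.Build k W E _ tau1 tau1_linear.
HB.instance Definition _ := GRing.isLinear.Build k W E _ tau2 tau2_linear.

(** * The product rule and preservation of degree *)

Section Derivation.
Variable T : {linear E -> E}.
Hypothesis T_inc : forall m w, homog m w ->
  T (inc w) = inc (L w) + (lambda / 2%:R * (-1) ^+ m * (m%:R - beta)) *:
    (inc (int (dif alpha) w) * theta).
Hypothesis T_inc_theta : forall w,
  T (inc w * theta) = inc (L w + w * alpha) * theta.
Hypothesis T_inc_dtheta : forall w, T (inc w * dif theta) =
  inc (L w + w * alpha) * dif theta + inc (w * dif alpha) * theta.

Lemma der_theta : T theta = inc alpha * theta.
Proof. by have := T_inc_theta 1; rewrite (inc1 hE) !mul1r L1 add0r. Qed.

Lemma der_dtheta : T (dif theta) = inc (dif alpha) * theta + inc alpha * dif theta.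
Proof. by have := T_inc_dtheta 1; rewrite (inc1 hE) !mul1r L1 add0r addrC. Qed.

Let T_theta m w : homog m w -> T (inc w) * theta = inc (L w) * theta.
Proof.
by move=> hw; rewrite (T_inc hw) mulrDl -scalerAl -[_ * theta * _]mulrA (theta_theta hE)
  mulr0 scaler0 addr0.
Qed.

Let T_dtheta m w : homog m w -> T (inc w) * dif theta = inc (L w) * dif theta.
Proof.
by move=> hw; rewrite (T_inc hw) mulrDl -scalerAl -[_ * theta * _]mulrA (theta_dtheta hE)
  mulr0 scaler0 addr0.
Qed.

Let theta_T m w : homog m w -> theta * T (inc w) = theta * inc (L w).
Proof.
by move=> hw; rewrite (T_inc hw) mulrDr -scalerAr [theta * (_ * _)]mulrA theta_inc_theta
  scaler0 addr0.
Qed.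

Let dtheta_T m w : homog m w -> dif theta * T (inc w) = dif theta * inc (L w).
Proof.
by move=> hw; rewrite (T_inc hw) mulrDr -scalerAr
  [dif theta * (_ * _)]mulrA dtheta_inc_theta scaler0 addr0.
Qed.

(** The product rule at one pair. It is additive in each argument and propagates through
    associativity, which reduces it to products with [inc], [theta] and [dif theta]. *)
Let D (x y : E) := T (x * y) = T x * y + x * T y.

Let D0l y : D 0 y. Proof. by rewrite /D mul0r linear0 !mul0r addr0. Qed.
Let D0r x : D x 0. Proof. by rewrite /D mulr0 linear0 !mulr0 addr0. Qed.

Let DDl x y z : D x z -> D y z -> D (x + y) z.
Proof. by rewrite /D mulrDl linearD /= => -> ->; rewrite linearD !mulrDl addrACA. Qed.

Let DDr x y z : D z x -> D z y -> D z (x + y).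
Proof. by rewrite /D mulrDr linearD /= => -> ->; rewrite linearD !mulrDr addrACA. Qed.

Let DAr x y z : D x y -> D (x * y) z -> D y z -> D x (y * z).
Proof.
by rewrite /D mulrA => -> -> ->; rewrite mulrDl mulrDr !mulrA addrA.
Qed.

Let DAl x y z : D x y -> D x (y * z) -> D y z -> D (x * y) z.
Proof.
by rewrite /D -mulrA => -> -> ->; rewrite mulrDl mulrDr !mulrA addrA.
Qed.

Let D_theta x : D x theta.
Proof.
elim/ext_ind: x => [|x y|n w hw|n w hw|n w hw]; [exact: D0l|exact: DDl|..].
- rewrite /D T_inc_theta (T_theta hw) der_theta.
  by rewrite linearD mulrDl mulrA inc_mul_theta.
- rewrite /D -mulrA (theta_theta hE) mulr0 linear0 T_inc_theta der_theta.
  rewrite -!mulrA (theta_theta hE) [theta * _]mulrA theta_inc_theta.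
  by rewrite !mulr0 addr0.
- rewrite /D -mulrA (dtheta_theta hE) mulr0 linear0 T_inc_dtheta der_theta.
  rewrite mulrDl -!mulrA (theta_theta hE) (dtheta_theta hE).
  by rewrite [dif theta * _]mulrA dtheta_inc_theta !mulr0 !addr0.
Qed.

Let D_dtheta x : D x (dif theta).
Proof.
elim/ext_ind: x => [|x y|n w hw|n w hw|n w hw]; [exact: D0l|exact: DDl|..].
- rewrite /D T_inc_dtheta (T_dtheta hw) der_dtheta.
  rewrite linearD mulrDl mulrDr !mulrA inc_mul_theta inc_mul_dtheta.
  by rewrite -addrA [X in _ + X]addrC.
- rewrite /D -mulrA (theta_dtheta hE) mulr0 linear0 T_inc_theta der_dtheta.
  rewrite -!mulrA (theta_dtheta hE) !mulr0 add0r.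
  by rewrite mulrDr ![theta * (_ * _)]mulrA theta_inc_theta theta_inc_dtheta addr0 mulr0.
- rewrite /D -mulrA (dtheta_dtheta hE) mulr0 linear0 T_inc_dtheta der_dtheta.
  rewrite mulrDl -!mulrA (theta_dtheta hE) (dtheta_dtheta hE).
  rewrite mulrDr ![dif theta * (_ * _)]mulrA dtheta_inc_theta dtheta_inc_dtheta.
  by rewrite !(mulr0, addr0).
Qed.

Let theta_D w : D theta (inc w).
Proof.
elim/homog_ind: w => [|x y|n w hw]; first by rewrite linear0; apply: D0r.
  by rewrite linearD; apply: DDr.
rewrite /D (theta_inc hE hw) linearZ /= D_theta (theta_T hw) (T_theta hw).
rewrite (theta_inc hE (homog_conf hL hw)) der_theta -mulrA (theta_inc hE hw).
rewrite -scalerAr !mulrA !inc_mul_theta (deg0_comm hcomm _ halpha).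
by rewrite scalerDr addrC.
Qed.

Let dtheta_D w : D (dif theta) (inc w).
Proof.
elim/homog_ind: w => [|x y|n w hw]; first by rewrite linear0; apply: D0r.
  by rewrite linearD; apply: DDr.
rewrite /D (dtheta_inc hE) D_dtheta (dtheta_T hw) (T_dtheta hw).
rewrite (dtheta_inc hE) der_dtheta mulrDl -!mulrA (theta_inc hE hw) (dtheta_inc hE).
rewrite -scalerAr mulrDr !mulrA !inc_mul_theta !inc_mul_dtheta.
rewrite (deg0_comm hcomm _ halpha) (hcomm hdalpha hw) mul1n linearZ /= -scalerAl.
by lin k.
Qed.

(** The coefficients of [theta] agree by [bracket_conf], those of [dif theta] by [perp_conf]. The
    term in [perp x y * dif alpha] is matched by the [theta] part of [T] on
    [inc (perp x y) * dif theta]. *)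
Let inc_D x y : D (inc x) (inc y).
Proof.
elim/homog_ind: x => [|x z|m x hx]; first by rewrite linear0; apply: D0l.
  by rewrite linearD; apply: DDl.
elim/homog_ind: y => [|y z|n y hy]; first by rewrite linear0; apply: D0r.
  by rewrite linearD; apply: DDr.
have hxy : homog (m + n) (x * y) by exact: homogM.
rewrite /D (T_inc hx) (T_inc hy) [(_ + _) * inc y]mulrDl.
rewrite [inc x * (_ + _)]mulrDr (inc_mul hE hx hy).
rewrite (inc_mul hE (homog_conf hL hx) hy) (inc_mul hE hx (homog_conf hL hy)).
have := bracket_conf hW hdelta hperp halpha hL hx hy.
move: (bracket _ _ _ (L x) _) (bracket _ _ _ _ (L y)) (bracket _ _ _ x y).
move=> B1 B2 B /(congr1 (fun z => inc z * theta)) EB.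
rewrite linearB linearD !linearZ /= (T_inc hxy) T_inc_theta T_inc_dtheta.
rewrite -!scalerAl -!scalerAr -[inc _ * theta * inc y]mulrA (theta_inc hE hy).
rewrite -scalerAr !mulrA !inc_mul_theta.
rewrite (int_mul hW hdelta _ hdalpha hx) !(deg0_comm hcomm _ halpha) (confM hL).
have EP := congr1 (fun z => inc z * dif theta) (perp_conf hW hdelta hperp halpha hL x y).
move: EB EP; rewrite !(linearD, linearN, linearZ) /= !(mulrDl, mulNr) -!scalerAl.
set h := lambda / 2%:R => EB EP.
apply: (lin_use (congr1 (fun z => (h * (-1) ^+ (m + n)) *: z) (esym EB))).
apply: (lin_use (congr1 (fun z => (h * (-1) ^+ m) *: z) (esym EP))).
by rewrite !mulNr; lin k.
Qed.

Let inc_D_ext x y : D (inc x) y.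
Proof.
elim/ext_ind: y => [|y z|n w hw|n w hw|n w hw].
- exact: D0r.
- exact: DDr.
- exact: inc_D.
- exact: DAr (inc_D x w) (D_theta _) (D_theta _).
- exact: DAr (inc_D x w) (D_dtheta _) (D_dtheta _).
Qed.

Let theta_D_ext y : D theta y.
Proof.
elim/ext_ind: y => [|y z|n w hw|n w hw|n w hw].
- exact: D0r.
- exact: DDr.
- exact: theta_D.
- exact: DAr (theta_D w) (D_theta _) (D_theta _).
- exact: DAr (theta_D w) (D_dtheta _) (D_dtheta _).
Qed.

Let dtheta_D_ext y : D (dif theta) y.
Proof.
elim/ext_ind: y => [|y z|n w hw|n w hw|n w hw].
- exact: D0r.
- exact: DDr.
- exact: dtheta_D.
- exact: DAr (dtheta_D w) (D_theta _) (D_theta _).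
- exact: DAr (dtheta_D w) (D_dtheta _) (D_dtheta _).
Qed.

Lemma tau_mul x y : T (x * y) = T x * y + x * T y.
Proof.
rewrite -/(D x y).
elim/ext_ind: x => [|x z|n w hw|n w hw|n w hw].
- exact: D0l.
- exact: DDl.
- exact: inc_D_ext.
- exact: DAl (D_theta _) (inc_D_ext w _) (theta_D_ext y).
- exact: DAl (D_dtheta _) (inc_D_ext w _) (dtheta_D_ext y).
Qed.

Lemma homog_tau n x : homog n x -> homog n (T x).
Proof.
have [hth hdth] := (homog_theta hE, homog_dif (homog_theta hE)).
move: n x; apply: ext_homog_ind => [n|n x y hx hy|n w hw|n w hw|n w hw].
- by rewrite linear0; apply: homog0.
- by rewrite linearD; apply: homogD.
- rewrite (T_inc hw); apply: homogD; first exact (homog_inc hE (homog_conf hL hw)).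
  case: n hw => [|n] hw.
    by rewrite (int0 hdelta) // linear0 mul0r scaler0; apply: homog0.
  rewrite -addn1; apply: homogZ; apply: homogM hth.
  exact (homog_inc hE (homog_int hdelta hdalpha hw)).
- rewrite T_inc_theta -addn1; apply: homogM hth; apply: (homog_inc hE).
  by apply: homogD; [exact (homog_conf hL hw) | rewrite -[n]addn0; apply: homogM].
- rewrite T_inc_dtheta; apply: homogD.
    rewrite -addn2; apply: homogM hdth; apply: (homog_inc hE).
    by apply: homogD; [exact (homog_conf hL hw) | rewrite -[n]addn0; apply: homogM].
  rewrite -[n.+2]addn1 -addn1; apply: homogM hth; apply: (homog_inc hE).
  exact: homogM.
Qed.

(** * Compatibility with the differential *)

Let dif_inc_int n w : homog n w ->
  dif (inc (int (dif alpha) w) * theta) =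
  inc (dif (int (dif alpha) w)) * theta
  - (-1) ^+ n *: (inc (int (dif alpha) w) * dif theta).
Proof.
case: n => [|n] hw.
  by rewrite (int0 hdelta) // !(linear0, mul0r) ?oppr0 ?addr0.
have hi := homog_int hdelta hdalpha hw.
rewrite (difM _ (homog_inc hE hi)) (dif_inc hE hi) !(mulrDl, mulNr) -!scalerAl.
rewrite -!mulrA (theta_theta hE) (dtheta_theta hE) !mulr0.
by rewrite exprS; lin k.
Qed.

(** The coefficients of [dif theta] agree by [conf_codif], those of [theta] by [laplacian_conf],
    whose term [dif alpha * delta w] is matched by the [theta] part of [T] on
    [inc (delta w) * dif theta]. *)
Let dif_der_inc n w : homog n w -> T (dif (inc w)) = dif (T (inc w)).
Proof.
move=> hw; rewrite (dif_inc hE hw) (T_inc hw).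
rewrite [dif (_ + _)]linearD [dif (_ *: _)]linearZ /= (dif_inc_int hw).
rewrite (dif_inc hE (homog_conf hL hw)) (conf_codif hL hw).
have := laplacian_conf halpha hL hw.
move: (laplacian _ (L w)) (laplacian _ w) => D1 D0 ->.
rewrite linearD linearB !linearZ /= (T_inc (homog_dif hw)) T_inc_theta T_inc_dtheta.
rewrite (conf_dif hL) !(deg0_comm hcomm _ halpha) (codif_form_comm hW hdelta hw hdalpha).
rewrite !(linearD, linearN, linearZ) /= !mulrDl -!scalerAl.
by lin k.
Qed.

Let dif_der_theta : T (dif theta) = dif (T theta).
Proof.
rewrite der_dtheta der_theta (difM _ (homog_inc hE halpha)) expr0 scale1r.
rewrite (dif_inc hE halpha) !(mulrDl, mulNr) -!scalerAl -!mulrA.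
by rewrite (theta_theta hE) (dtheta_theta hE) !(mulr0, scaler0) subr0 addr0.
Qed.

(** Two derivations that commute on the factors commute on the product; the signs agree because [T]
    preserves degree. *)
Let dif_der_mul n x y : homog n x -> T (dif x) = dif (T x) ->
  T (dif y) = dif (T y) -> T (dif (x * y)) = dif (T (x * y)).
Proof.
move=> hx dTx dTy; rewrite (difM _ hx) linearD linearZ /= !tau_mul dTx dTy.
rewrite [dif (_ + _)]linearD /= (difM _ hx) (difM _ (homog_tau hx)).
by lin k.
Qed.

Lemma tau_dif x : T (dif x) = dif (T x).
Proof.
elim/ext_ind: x => [|x y IHx IHy|n w hw|n w hw|n w hw].
- by rewrite !linear0.
- by rewrite !linearD /= IHx IHy.
- exact: dif_der_inc hw.
- exact: dif_der_mul (homog_inc hE hw) (dif_der_inc hw) dif_der_theta.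
- apply: dif_der_mul (homog_inc hE hw) (dif_der_inc hw) _.
  by rewrite dif_der_theta !difK linear0.
Qed.

Lemma tau_dga_derivation : dga_derivation T.
Proof.
split; [|exact: homog_tau|exact: tau_mul|exact: tau_dif].
by move=> c x y; rewrite linearP.
Qed.

End Derivation.

End ExtendedAlgebra.

(** * Comparison with the quantum calculus *)

Section CalculusRelations.
Variables (k : fieldType) (hk : 2%N \notin [pchar k]).
Variables (W : dga k) (hW : classical_dga W).
Variables (delta : {linear W -> W}) (int perp : W -> W -> W).
Hypotheses (hdelta : classical_codifferential delta int) (hperp : is_perp int perp).
Variables (tau alpha : W) (beta lambda : k).
Hypotheses (htau : homog 1 tau) (halpha : homog 0 alpha).
Variables (E : dga k) (inc : {linear W -> E}) (theta : E).
Hypothesis hE : is_extended delta perp lambda inc theta.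
Variable T : E -> E.
Hypothesis derT : dga_derivation T.
Hypothesis T_theta : T theta = inc alpha * theta.
Hypothesis T_dtheta :
  T (dif theta) = inc (dif alpha) * theta + inc alpha * dif theta.
Hypothesis T_inc : forall m w, homog m w ->
  T (inc w) = inc (lie int tau w)
    + (lambda / 2%:R * (-1) ^+ m * (m%:R - beta)) *:
        (inc (int (dif alpha) w) * theta).
Variables (d : nat) (B : dga k) (f : {lrmorphism E -> B}) (t : B).
Hypotheses (hbeta : beta = d%:R / 2%:R) (hf : dga_morphism f) (ht : homog 0 t).

Let hstd : standard W. Proof. by case: hW. Qed.
Let hdalpha : homog 1 (dif alpha). Proof. exact: homog_dif. Qed.
Let hth : homog 1 theta. Proof. exact: homog_theta hE. Qed.
Let hdth : homog 2 (dif theta). Proof. exact: homog_dif. Qed.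

Let T_inc0 a : homog 0 a -> T (inc a) = inc (lie int tau a).
Proof.
by move=> ha; rewrite (T_inc ha) (int0 hdelta) // linear0 mul0r scaler0 addr0.
Qed.

Let n2 : 2%:R != 0 :> k.
Proof. by move: hk; rewrite inE. Qed.

(** With [beta] half the dimension, the correction in degree 1 is exactly the coefficient of the
    quantum calculus. *)
Let dimension_coef : lambda * (lambda / 2%:R * (-1) ^+ 1 * (1%:R - beta)) =
  lambda ^+ 2 * ((d%:R - 2%:R) / 4%:R).
Proof.
have n4 : 4%:R != 0 :> k by rewrite (natrM _ 2 2) mulf_neq0.
by rewrite hbeta; field; rewrite ?n2 ?n4.
Qed.

Let T_inc1 w : homog 1 w -> lambda *: f (T (inc w)) =
  lambda *: f (inc (lie int tau w))
  + (lambda ^+ 2 * ((d%:R - 2%:R) / 4%:R)) *: f (inc (int (dif alpha) w) * theta).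
Proof.
move=> hw; rewrite (T_inc hw) rmorphD /= [f (_ *: _)]linearZ /= scalerDr scalerA.
by rewrite dimension_coef.
Qed.

Lemma semidirect_quantum_calculus :
  semidirect_relations T lambda f t ->
  quantum_calculus_relations int tau alpha d lambda inc theta f t.
Proof.
case=> ht_dt rel_t rel_dt; split=> //.
  move=> a ha; have hia := homog_inc hE ha.
  by rewrite (rel_t _ _ hia) (T_inc0 ha) scale0r subr0.
split; split.
- move=> w hw; rewrite (rel_t _ _ (homog_inc hE hw)) scale1r !scalerBr (T_inc1 hw).
  by rewrite addrAC.
- by rewrite (rel_t _ _ hth) T_theta scale1r mulrBl mul1r rmorphB.
- rewrite (rel_t _ _ hdth) T_dtheta mulrBl addrA [in RHS]rmorphB /=.
  congr (_ *: (_ - _)); rewrite rmorphM rmorph_nat.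
  by rewrite mulr_natl scaler_nat.
- move=> a ha; have := rel_dt _ _ (homog_inc hE ha).
  by rewrite expr0 scale1r.
- move=> w hw; have := rel_dt _ _ (homog_inc hE hw).
  by rewrite expr1 scaleN1r opprK.
- by have := rel_dt _ _ hth; rewrite expr1 scaleN1r opprK.
Qed.

(** A first argument of degree 1 is enough, as induction on forms multiplies by one 1-form at a
    time. *)
Lemma homog_bracket1 n w x : homog 1 w -> homog n x ->
  homog n (bracket delta perp 1 w x).
Proof.
move=> hw hx; rewrite /bracket /codif_defect.
have hwx : homog n.+1 (w * x) := homogM hw hx.
have hpdx := homog_perp hW hdelta hperp hw (homog_dif hx).
have hdwp := homog_perp hW hdelta hperp (homog_dif hw) hx.
have hdw := homogM (homog_codif hdelta hw) hx.
apply: homogB; [apply: homogB; [apply: homogD => //; apply: homogB;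
  [apply: homogB => //; exact (homog_codif hdelta hwx)|]|]|]; apply: homogZ => //.
  case: n hx {hwx hpdx hdwp hdw} => [|n] hx.
    by rewrite (codif0 hdelta) // mulr0; apply: homog0.
  exact: homogM hw (homog_codif hdelta hx).
case: n hx {hwx hpdx hdwp hdw} => [|n] hx.
  by rewrite (perp0r hperp) // linear0; apply: homog0.
exact: homog_dif (homog_perp hW hdelta hperp hw hx).
Qed.

Let rel (n : nat) (x : E) : Prop :=
  [/\ homog n x,
      t * f x - f x * t = lambda *: (f (T x) - n%:R *: f x)
    & dif t * f x - (-1) ^+ n *: (f x * dif t) = lambda *: f (dif x)].

(** * Closure of the relations under linear combinations and products *)

Let T0 : T 0 = 0.
Proof. by have := der_linear derT (-1) 0 0; rewrite !scaleN1r oppr0 addr0 addNr. Qed.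

Let TD x y : T (x + y) = T x + T y.
Proof. by have := der_linear derT 1 x y; rewrite !scale1r. Qed.

Let TZ c x : T (c *: x) = c *: T x.
Proof. by have := der_linear derT c x 0; rewrite T0 !addr0. Qed.

Let rel0 n : rel n 0.
Proof.
by split; [exact: homog0|..];
  rewrite ?T0 !(linear0, mulr0, mul0r, subrr, scaler0).
Qed.

Let relD n x y : rel n x -> rel n y -> rel n (x + y).
Proof.
case=> hx tx dx [hy ty dy]; split; first exact: homogD.
  rewrite TD !rmorphD /= mulrDr mulrDl.
  by apply: (lin_use tx); apply: (lin_use ty); lin k.
rewrite [dif (_ + _)]linearD !rmorphD /= mulrDr mulrDl.
by apply: (lin_use dx); apply: (lin_use dy); lin k.
Qed.

Let relZ n c x : rel n x -> rel n (c *: x).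
Proof.
case=> hx tx dx; split; first exact: homogZ.
  rewrite TZ [f (_ *: T x)]linearZ [f (_ *: x)]linearZ /= -scalerAr -scalerAl.
  by apply: (lin_use (congr1 (fun z => c *: z) tx)); lin k.
rewrite [dif (_ *: _)]linearZ [f (_ *: dif x)]linearZ [f (_ *: x)]linearZ /=.
rewrite -scalerAr -scalerAl.
by apply: (lin_use (congr1 (fun z => c *: z) dx)); lin k.
Qed.

(** Both sides of each relation obey the same Leibniz rule: the degree is additive on products, [T]
    is a derivation, and [dif] is a graded one. *)
Let relM m n x y : rel m x -> rel n y -> rel (m + n) (x * y).
Proof.
case=> hx tx dx [hy ty dy]; split; first exact: homogM.
  rewrite (der_mul derT) rmorphD !rmorphM /= mulrA.
  have := congr1 (fun z => z * f y) tx; have := congr1 (fun z => f x * z) ty.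
  rewrite !(mulrBl, mulrBr) -!scalerAl -!scalerAr !(mulrBl, mulrBr) -!scalerAl.
  rewrite -!scalerAr !mulrA => Ey Ex.
  by apply: (lin_use Ex); apply: (lin_use Ey); lin k.
rewrite (difM _ hx) rmorphD /= [f (_ *: _)]linearZ !rmorphM /= mulrA.
have := congr1 (fun z => z * f y) dx; have := congr1 (fun z => f x * z) dy.
rewrite !(mulrBl, mulrBr) -!scalerAl -!scalerAr -?scalerAl !mulrA => Ey Ex.
apply: (lin_use Ex); apply: (lin_use (congr1 (fun z => (-1) ^+ m *: z) Ey)).
by lin k.
Qed.

(** * From the relations on generators to those on the whole extended algebra *)

Section QuantumCalculus.
Hypothesis hQ : quantum_calculus_relations int tau alpha d lambda inc theta f t.

Let rel_inc0 a : homog 0 a -> rel 0 (inc a).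
Proof.
move=> ha; case: hQ => _ rel_a [_ [rel_da _ _]]; split.
- exact: (homog_inc hE ha).
- by rewrite rel_a // (T_inc0 ha) scale0r subr0.
- by rewrite expr0 scale1r rel_da.
Qed.

Let rel_inc1 w : homog 1 w -> rel 1 (inc w).
Proof.
move=> hw; case: hQ => _ _ [[rel_w _ _] [_ rel_dw _]]; split.
- exact: (homog_inc hE hw).
- by rewrite rel_w // !scalerBr (T_inc1 hw) scale1r addrAC.
- by rewrite expr1 scaleN1r opprK rel_dw.
Qed.

Let rel_theta : rel 1 theta.
Proof.
case: hQ => _ _ [[_ rel_th _] [_ _ rel_dth]]; split=> //.
- by rewrite rel_th T_theta scale1r mulrBl mul1r rmorphB.
- by rewrite expr1 scaleN1r opprK.
Qed.

(* The relation of [dt] with [d theta] is the differential of the one with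
   [theta]. *)
Let rel_dtheta : rel 2 (dif theta).
Proof.
case: hQ => _ _ [[_ _ rel_dth] [_ _ rel_th]]; split=> //.
  rewrite rel_dth T_dtheta mulrBl addrA rmorphB /=.
  by rewrite rmorphM rmorph_nat mulr_natl scaler_nat.
have := congr1 dif rel_th.
rewrite linearD linearZ /= -(proj2 hf) (difM _ (homog_dif ht)).
rewrite (difM _ (proj1 hf _ _ hth)) -(proj2 hf) !difK linear0 !mulr0 mul0r.
rewrite !scaler0 add0r addr0 expr1 scaleN1r => E1.
by apply: (lin_use (congr1 (fun z => - z) E1)); lin k.
Qed.

(** In front of [theta], [inc] is multiplicative, so [relM] applies one 1-form at a time. *)
Let rel_inc_theta n w : homog n w -> rel n.+1 (inc w * theta).
Proof.
move: n w; apply: (graded_form_ind hstd) => [n|n x y rx ry|a ha|n w x hw hx rx].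
- by rewrite linear0 mul0r.
- by rewrite linearD mulrDl; apply: relD.
- exact: relM (rel_inc0 ha) rel_theta.
- by rewrite -(inc_mul_theta hE) -mulrA; apply: relM (rel_inc1 hw) rx.
Qed.

Let rel_inc_dtheta n w : homog n w -> rel n.+2 (inc w * dif theta).
Proof.
move: n w; apply: (graded_form_ind hstd) => [n|n x y rx ry|a ha|n w x hw hx rx].
- by rewrite linear0 mul0r.
- by rewrite linearD mulrDl; apply: relD.
- exact: relM (rel_inc0 ha) rel_dtheta.
- by rewrite -(inc_mul_dtheta hE) -mulrA; apply: relM (rel_inc1 hw) rx.
Qed.

Let rel_inc n w : homog n w -> rel n (inc w).
Proof.
move: n w; apply: (graded_form_ind hstd) => [n|n x y rx ry|a ha|n w x hw hx rx].
- by rewrite linear0.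
- by rewrite linearD; apply: relD.
- exact: rel_inc0.
have := inc_mul hE hw hx.
set c1 := lambda / 2%:R * _; set c2 := lambda / 2%:R * _.
set b := bracket _ _ _ _ _ => mul_wx.
(* The product formula solved for [inc (w * x)]: the corrections lie in the two summands already
   treated. *)
have -> : inc (w * x) = inc w * inc x + (- c1) *: (inc b * theta)
    + c2 *: (inc (perp w x) * dif theta).
  by rewrite mul_wx; lin k.
apply: relD; first apply: relD.
- exact: relM (rel_inc1 hw) rx.
- exact/relZ/rel_inc_theta/homog_bracket1.
(* For [x] of degree 0 the degree of [perp w x] would be truncated, but [perp w x] is 0. *)
apply: relZ; case: n hx {rx mul_wx c1 c2 b} => [|n] hx.
  by rewrite (perp0r hperp) // linear0 mul0r.
exact: rel_inc_dtheta (homog_perp hW hdelta hperp hw hx).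
Qed.

Lemma quantum_calculus_semidirect : semidirect_relations T lambda f t.
Proof.
have relP : forall n x, homog n x -> rel n x.
  exact: ext_homog_ind hE _ rel0 relD rel_inc rel_inc_theta rel_inc_dtheta.
case: hQ => ht_dt _ _; split=> // n x /relP[] //.
Qed.

End QuantumCalculus.

End CalculusRelations.

(** * Existence and uniqueness of the derivation, and comparison of the two presentations *)

Theorem proposition4p6 (k : fieldType) (hk : 2%N \notin [pchar k])
    (W : dga k) (hW : classical_dga W)
    (delta : {linear W -> W}) (int : W -> W -> W)
    (hdelta : classical_codifferential delta int)
    (perp : W -> W -> W) (hperp : is_perp int perp)
    (tau alpha : W) (beta : k)
    (htau : homog 1 tau) (halpha : homog 0 alpha)
    (hconf : strongly_conformal delta int tau alpha beta)
    (lambda : k) (hlambda : lambda != 0)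
    (E : dga k) (inc : {linear W -> E}) (theta : E)
    (hE : is_extended delta perp lambda inc theta) :
  let is_tau (T : E -> E) :=
    [/\ dga_derivation T,
        T theta = inc alpha * theta,
        T (dif theta) = inc (dif alpha) * theta + inc alpha * dif theta
      & forall m w, homog m w ->
          T (inc w) = inc (lie int tau w)
            + (lambda / 2%:R * (-1) ^+ m * (m%:R - beta)) *:
                (inc (int (dif alpha) w) * theta)] in
  exists T : E -> E,
    [/\ is_tau T,
        forall T' : E -> E, is_tau T' -> T' =1 T
      & forall n : nat, beta = n%:R / 2%:R ->
        forall (S : dga k) (j : {lrmorphism E -> S}) (t : S),
          is_semidirect T lambda j t <->
          is_quantum_calculus int tau alpha n lambda inc theta j t].
Proof.
move=> is_tau.
pose L : {linear W -> W} := HB.pack (lie int tau)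
  (GRing.isLinear.Build k W W _ (lie int tau) (lie_linear hdelta htau)).
have hL : conformal_derivation delta int L alpha beta.
  split=> [x y|x|n x hx|n x hx] /=.
  - exact: (lieM hW hdelta).
  - exact: (lie_dif hdelta).
  - exact: (homog_lie hdelta).
  - by apply: (lin_use (hconf _ _ hx)); lin k.
pose T : {linear E -> E} := HB.pack
  (ext_map hE (tau0 delta lambda inc theta L alpha) (tau1 inc theta L alpha)
     (tau2 inc theta L alpha))
  (GRing.isLinear.Build k E E _ _ (ext_map_linear hE _ _ _)).
have T_inc m w : homog m w -> T (inc w) = inc (L w)
    + (lambda / 2%:R * (-1) ^+ m * (m%:R - beta)) *:
        (inc (int (dif alpha) w) * theta).
  move=> hw; rewrite -(tau0E hE hdelta halpha hL hw); exact: ext_map_inc.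
have T_inc_theta w : T (inc w * theta) = inc (L w + w * alpha) * theta.
  exact: ext_map_theta.
have T_inc_dtheta w : T (inc w * dif theta) =
    inc (L w + w * alpha) * dif theta + inc (w * dif alpha) * theta.
  exact: ext_map_dtheta.
have tauT : is_tau T.
  split.
  - exact: (tau_dga_derivation hE hW hdelta hperp halpha hL T_inc).
  - exact: (der_theta hE hL).
  - exact: (der_dtheta hE hL).
  - exact: T_inc.
exists T; split=> // [T' [derT' T'th T'dth T'inc] | n hbeta S j t].
  (* Uniqueness: the prescribed values fix [T'] on [inc w], and the product rule fixes it on the
     other two summands. *)
  case: tauT => derT Tth Tdth Tinc.
  have T'0 : T' 0 = 0.
    by have := der_linear derT' (-1) 0 0; rewrite !scaleN1r oppr0 addr0 addNr.
  elim/(ext_ind hE) => [|x y IHx IHy|m w hw|m w hw|m w hw].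
  - by rewrite T'0 linear0.
  - by have := der_linear derT' 1 x y; rewrite !scale1r IHx IHy linearD.
  - by rewrite (T'inc _ _ hw) (Tinc _ _ hw).
  - by rewrite (der_mul derT) (der_mul derT') T'th Tth (T'inc _ _ hw) (Tinc _ _ hw).
  - by rewrite (der_mul derT) (der_mul derT') T'dth Tdth (T'inc _ _ hw) (Tinc _ _ hw).
(* The equivalence is needed in every target [B]: in [S] to transfer the relations, and in test
   algebras to transfer the universal property. *)
have rel_iff (B : dga k) (f : {lrmorphism E -> B}) (s : B) :
    dga_morphism f -> homog 0 s ->
    semidirect_relations T lambda f s <->
    quantum_calculus_relations int tau alpha n lambda inc theta f s.
  case: tauT => derT Tth Tdth Tinc hf hs; split.
    exact: (semidirect_quantum_calculus hk hdelta halpha hE Tth Tdth Tinc hbeta).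
  exact: (quantum_calculus_semidirect hk hW hdelta hperp halpha hE derT Tth Tdth
    Tinc hbeta hf hs).
split=> -[hj ht hR univ]; split=> //; try exact/rel_iff.
  by move=> B f s hf hs /(rel_iff _ _ _ hf hs); apply: univ.
by move=> B f s hf hs /(rel_iff _ _ _ hf hs); apply: univ.
Qed.
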